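(* Let $X$ be an infinite dimensional, separable $F$-space and $T\in\mathcal{L}(X)$. Then $(X,T)$ is strongly transitive if and only if there exists a dense set $D\subset X$ satisfying: (i) For every $x\in D$ there exists $n\in\mathbb{N}$ such that $T^n(x)=0$. (ii) For every $y\in X$ there exist a sequence $(n_k)$ in $\mathbb{N}$ and points $y_k\in T^{-n_k}(y)$ ($k\in\mathbb{N}$) such that $y_k\to 0$ as $k\to\infty$.
   Context: $\mathbb{N}=\{1,2,3,\dots\}$. $\mathcal{L}(X)$ is the set of all bounded (i.e. continuous) linear operators on $X$. $T^{-n}(y)=\{z\in X:T^n(z)=y\}$ ($T$ is not assumed invertible). $(X,T)$ is strongly transitive if for every non-empty open $U\subset X$, $\bigcup_{n=1}^{\infty}T^n(U)=X$. *)

(* Defs.v *)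
From HB Require Import structures.
From mathcomp Require Import all_boot all_order all_algebra.
From mathcomp Require Import complex.
From mathcomp Require Import all_classical all_reals.
From mathcomp Require Import topology tvs.

Set Implicit Arguments.
Unset Strict Implicit.
Unset Printing Implicit Defensive.

Import Order.TTheory GRing.Theory Num.Theory.
Local Open Scope classical_set_scope.
Local Open Scope ring_scope.

Variant scalar_kind := RealScalars | ComplexScalars.

Definition scalar_field (R : realType) (s : scalar_kind) : numFieldType :=
  match s with RealScalars => R | ComplexScalars => R[i]%C end.

(* Distances are real-valued also when the scalars are complex, so the metric
   cannot be the library's metric structure over the field of scalars.
   Nonnegativity of d follows from the first three fields. *)
Record complete_invariant_metric (R : realType) (K : numFieldType)
    (X : topologicalLmodType K) (d : X -> X -> R) : Prop :=
  CompleteInvariantMetric {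
    dist_eq0 : forall x y, d x y = 0 <-> x = y ;
    dist_sym : forall x y, d x y = d y x ;
    dist_triangle : forall y x z, d x z <= d x y + d y z ;
    dist_translation : forall x y z, d (x + z) (y + z) = d x y ;
    dist_nbhs : forall (x : X) (A : set X),
      nbhs x A <-> exists2 e : R, 0 < e & [set y | d x y < e] `<=` A ;
    dist_complete : forall u : nat -> X,
      (forall e : R, 0 < e -> exists N : nat, forall m n : nat,
         (N <= m)%N -> (N <= n)%N -> d (u m) (u n) < e) ->
      exists l : X, u @ \oo --> l }.

(* Local convexity is not required, hence topologicalLmodType and not the
   library's tvsType. *)
Definition F_space (R : realType) (K : numFieldType)
    (X : topologicalLmodType K) : Prop :=
  exists d : X -> X -> R, complete_invariant_metric d.

Definition finite_dimensional (K : numFieldType) (X : lmodType K) : Prop :=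
  exists s : seq X, forall x : X,
    exists c : 'I_(size s) -> K, x = \sum_(i < size s) c i *: s`_i.

Definition separable (X : topologicalType) : Prop :=
  exists2 A : set X, countable A & dense A.

Definition strongly_transitive (X : topologicalType) (T : X -> X) : Prop :=
  forall U : set X, open U -> U !=set0 ->
    \bigcup_(n in [set n : nat | (0 < n)%N]) (iter n T @` U) = [set: X].

(* Main.v *)
(** For the converse direction, let x in U be killed by T^m and let y <> 0.
    The preimages y_k of y under T^(n_k) tend to 0, whereas each single
    preimage T^(-n)(y) stays away from 0 by continuity; hence n_k >= m for
    large k, and then x + y_k is a point of U mapped to y by T^(n_k). *)
Require Import Defs.
From HB Require Import structures.
From mathcomp Require Import all_boot all_order all_algebra.
From mathcomp Require Import all_classical all_reals.
From mathcomp Require Import topology tvs.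

Set Implicit Arguments.
Unset Strict Implicit.
Unset Printing Implicit Defensive.

Import Order.TTheory GRing.Theory Num.Theory.
Local Open Scope classical_set_scope.
Local Open Scope ring_scope.

Lemma iter_raddf0 (V : zmodType) (f : {additive V -> V}) (n : nat) :
  iter n f 0 = 0.
Proof. by elim: n => //= n ->; rewrite raddf0. Qed.

Lemma iter_raddfD (V : zmodType) (f : {additive V -> V}) (n : nat) (x y : V) :
  iter n f (x + y) = iter n f x + iter n f y.
Proof. by elim: n => //= n ->; rewrite raddfD. Qed.

Lemma continuous_iter (X : topologicalType) (f : X -> X) (n : nat) :
  continuous f -> continuous (iter n f).
Proof.
move=> fc; elim: n => [|n IHn] x /=; first exact: cvg_id.
by apply: continuous_comp; [exact: IHn | exact: fc].
Qed.

Section FSpace.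
Variables (R : realType) (K : numFieldType) (X : topologicalLmodType K).

(** The balls of radius 1/(k+1) around [x] shrink to [x]. Stating this with neighbourhoods lets
    convergent sequences be built later without mentioning the metric. *)
Lemma F_space_nbhs_seq (x : X) : F_space R X ->
  exists2 B : nat -> set X, forall k, nbhs x (B k) &
    forall u : nat -> X, (forall k, B k (u k)) -> u @ \oo --> x.
Proof.
move=> [d dX]; exists (fun k => [set y | d x y < k.+1%:R^-1]) => [k|u uB A].
  by apply/(dist_nbhs dX); exists k.+1%:R^-1; rewrite ?invr_gt0.
move=> /(dist_nbhs dX)[e e0 eA].
(* If k is at least the integer part of 1/e, then k+1 > 1/e, so the k-th radius is below e. *)
exists (Num.truncn e^-1) => // k /= ek; apply: eA => /=.
apply: lt_trans (uB k) _; rewrite invf_plt ?posrE//.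
apply: lt_le_trans (truncnS_gt _) _.
by rewrite ler_nat.
Qed.

(** The ball around [x] of radius [d x y] misses [y]. *)
Lemma F_space_nbhs_neq (x y : X) : F_space R X -> x <> y ->
  nbhs x [set z | z <> y].
Proof.
move=> [d dX] xy; apply/(dist_nbhs dX).
have d0 z : d z z = 0 by apply/(dist_eq0 dX).
have dxy : 0 < d x y.
  rewrite lt_neqAle; apply/andP; split.
    by apply/eqP => /esym/(dist_eq0 dX).
  (* Nonnegativity: 0 = d(x,x) <= d(x,y) + d(y,x) = 2 d(x,y). *)
  have := dist_triangle dX y x x.
  by rewrite d0 (dist_sym dX y) -mulr2n pmulrn_lge0.
by exists (d x y) => // z /= + zy; rewrite zy ltxx.
Qed.

(** Each iterate is continuous and fixes 0, which differs from [y], so it avoids [y] near 0;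
    finitely many such neighbourhoods are intersected by induction on [m]. *)
Lemma near0_iter_neq (T : {linear X -> X}) (y : X) (m : nat) :
  F_space R X -> continuous T -> y <> 0 ->
  \forall z \near (0 : X), forall n, (n < m)%N -> iter n T z <> y.
Proof.
move=> FX Tc y0; elim: m => [|m IHm]; first exact: nearW.
have Tm : \forall z \near (0 : X), iter m T z <> y.
  have Tm_cvg : iter m T @ (0 : X) --> iter m T 0 by exact: continuous_iter.
  apply: (Tm_cvg [set z | z <> y]); rewrite iter_raddf0.
  by apply: F_space_nbhs_neq => // /esym.
apply: filterS2 IHm Tm => z zlt zm n.
by rewrite ltnS leq_eqVlt => /predU1P[->//|]; exact: zlt.
Qed.

End FSpace.

Theorem theorem4p1 (R : realType) (s : scalar_kind)
    (X : topologicalLmodType (scalar_field R s)) (T : {linear X -> X}) :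
  F_space R X -> ~ finite_dimensional X -> separable X -> continuous T ->
  (strongly_transitive T <->
   exists D : set X,
     [/\ dense D,
         forall x : X, D x -> exists2 n : nat, (0 < n)%N & iter n T x = 0
       & forall y : X, exists (n_ : nat -> nat) (y_ : nat -> X),
           [/\ forall k : nat, (0 < n_ k)%N,
               forall k : nat, (iter (n_ k) T @^-1` [set y]) (y_ k)
             & y_ @ \oo --> (0 : X)]]).
Proof.
move=> FX _ _ Tc; split=> [Ttrans|[D [Ddense Dnil Dpre]] U Uopen U0].
  have Thit (U : set X) y : open U -> U !=set0 ->
      exists n x, [/\ (0 < n)%N, U x & iter n T x = y].
    move=> Uo U0; have : [set: X] y by [].
    by rewrite -(Ttrans U Uo U0) => -[n /= n0 [x Ux xy]]; exists n, x.
  (* The largest possible [D] is taken; its density is strong transitivity with target 0. *)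
  exists [set x | exists2 n : nat, (0 < n)%N & iter n T x = 0]; split=> //.
    move=> U U0 Uo; have [n [x [n0 Ux Tx]]] := Thit U 0 Uo U0.
    by exists x; split=> //; exists n.
  move=> y; have [B Bnbhs Bcvg] := F_space_nbhs_seq 0 FX.
  (* Strong transitivity on the interior of [B k] puts a preimage of [y] inside [B k]; exponent and
     point are chosen together. *)
  have /choice[p pP] k : exists p : nat * X,
      [/\ (0 < p.1)%N, B k p.2 & iter p.1 T p.2 = y].
    have [] := Thit (B k)° y (open_interior _).
      by exists 0; exact: Bnbhs.
    by move=> n [x [n0 /interior_subset Bx Tx]]; exists (n, x).
  exists (fun k => (p k).1), (fun k => (p k).2); split=> [k|k|].
  - by case: (pP k).
  - by case: (pP k).
  - by apply: Bcvg => k; case: (pP k).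
apply/seteqP; split=> // y _.
have [x [Ux Dx]] := Ddense U U0 Uopen.
have [m m0 Tmx] := Dnil x Dx.
(* The target 0 is set apart because every iterate maps 0 to it; here [x] itself is the preimage in
   [U]. *)
have [->|/eqP y0] := eqVneq y 0; first by exists m => //; exists x.
have [n_ [y_ [n_gt0 Ty_ y_cvg]]] := Dpre y.
have n_ge : \forall k \near \oo, (m <= n_ k)%N.
  have : \forall k \near \oo, forall n, (n < m)%N -> iter n T (y_ k) <> y.
    exact: (y_cvg _ (near0_iter_neq m FX Tc y0)).
  apply: filterS => k ykP.
  by rewrite leqNgt; apply/negP => /ykP; apply; exact: Ty_.
have Uxy : \forall k \near \oo, U (x + y_ k).
  have xy_cvg : (fun k => x + y_ k) @ \oo --> x.
    rewrite -[x in _ --> x]addr0.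
    apply: (@continuous2_cvg _ _ _ _ _ _ (fun=> x) y_ +%R x 0).
    - exact: (add_continuous (x, 0)).
    - exact: cvg_cst.
    - exact: y_cvg.
  by apply: (xy_cvg U); exact: open_nbhs_nbhs.
have [k [mk Uk]] := filter_ex (filterI n_ge Uxy).
exists (n_ k) => //=; exists (x + y_ k) => //.
(* Since [m <= n_ k], the [n_ k]-th iterate applies [T] another [n_ k - m] times to T^m(x) = 0, so
   the [x] term vanishes. *)
rewrite iter_raddfD (Ty_ k) -(subnK mk) iterD Tmx.
by rewrite iter_raddf0 add0r.
Qed.
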